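(* Let $n$ be a positive integer. Let $c,\tilde c,x_*,\tilde x_*\in\mathbb{R}^n$, $d,\tilde d\in\mathbb{R}$, $\delta,\tilde\delta\ge 0$, and let $M,\tilde M\in\mathbb{R}^{n\times n}$ be positive semidefinite. Suppose that $f:\mathbb{R}^n\to\mathbb{R}$ satisfies, for all $x\in\mathbb{R}^n$, $$f(x)=c^Tx+d-\sqrt{\delta^2+(x-x_* )^TM(x-x_* )}=\tilde c^Tx+\tilde d-\sqrt{\tilde\delta^2+(x-\tilde x_* )^T\tilde M(x-\tilde x_* )}.$$ (1) If $M=0$ (the zero matrix), then $\tilde c=c$, $\tilde M=0$, $\tilde d-\tilde\delta=d-\delta$, and $\tilde x_*$ is arbitrary (i.e. any vector $\tilde x_*\in\mathbb{R}^n$ can occur). (2) If $M\ne 0$, then $\tilde c=c$, $\tilde d=d$, $\tilde\delta=\delta$, $\tilde M=M$, and $M\tilde x_*=Mx_*$. As a consequence, the parameterization of $f$ in the form $f(x)=c^Tx+d-\sqrt{\delta^2+(x-x_* )^TM(x-x_* )}$ is unique if and only if $M$ is positive definite.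
   Context: A positive semidefinite (respectively positive definite) matrix is a real symmetric matrix with all eigenvalues non-negative (respectively positive). The parameterization of $f$ by $(c,d,\delta,M,x_* )$, where $c,x_*\in\mathbb{R}^n$, $d\in\mathbb{R}$, $\delta\ge0$ and $M$ is positive semidefinite, is unique if every tuple $(\tilde c,\tilde d,\tilde\delta,\tilde M,\tilde x_* )$ satisfying the same requirements and defining the same function $f$ on $\mathbb{R}^n$ equals $(c,d,\delta,M,x_* )$. *)

(* Defs.v *)
From mathcomp Require Import all_boot all_order all_algebra.
From mathcomp Require Import reals.

Set Implicit Arguments.
Unset Strict Implicit.
Unset Printing Implicit Defensive.

Import Order.TTheory GRing.Theory Num.Theory.
Local Open Scope ring_scope.

(* [eigenvalue] only sees eigenvalues lying in [R]; this loses nothing, since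
   the eigenvalues of a real symmetric matrix are all real. *)
Definition psdmx (R : realType) (n : nat) (M : 'M[R]_n) : Prop :=
  M^T = M /\ forall a : R, eigenvalue M a -> 0 <= a.

Definition pdmx (R : realType) (n : nat) (M : 'M[R]_n) : Prop :=
  M^T = M /\ forall a : R, eigenvalue M a -> 0 < a.

(* [Num.sqrt] is 0 on negative arguments, but for [M] positive semidefinite the
   radicand is always nonnegative. *)
Definition sqrt_form (R : realType) (n : nat) (c : 'cV[R]_n) (d delta : R)
    (M : 'M[R]_n) (xs x : 'cV[R]_n) : R :=
  (c^T *m x) 0 0 + d
  - Num.sqrt (delta ^+ 2 + ((x - xs)^T *m M *m (x - xs)) 0 0).

Definition parameterizes (R : realType) (n : nat) (f : 'cV[R]_n -> R)
    (c : 'cV[R]_n) (d delta : R) (M : 'M[R]_n) (xs : 'cV[R]_n) : Prop :=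
  [/\ 0 <= delta, psdmx M & forall x, f x = sqrt_form c d delta M xs x].

Definition unique_parameterization (R : realType) (n : nat)
    (f : 'cV[R]_n -> R) (c : 'cV[R]_n) (d delta : R) (M : 'M[R]_n)
    (xs : 'cV[R]_n) : Prop :=
  forall (c' : 'cV[R]_n) (d' delta' : R) (M' : 'M[R]_n) (xs' : 'cV[R]_n),
    parameterizes f c' d' delta' M' xs' ->
    (c', d', delta', M', xs') = (c, d, delta, M, xs).

(* Main.v *)
Require Import Defs.
From mathcomp Require Import all_boot all_order all_algebra.
From mathcomp Require Import reals.
From mathcomp Require Import boolp classical_sets ring lra.

Set Implicit Arguments.
Unset Strict Implicit.
Unset Printing Implicit Defensive.

Import Order.TTheory GRing.Theory Num.Theory.
Local Open Scope ring_scope.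

(** Write [quad M x] for the value at [x] of the quadratic form of [M].

    When [M] is nonzero, the affine parts of two representations must agree.
    Fix a point and a direction [v] with [quad M v > 0].  On the line through
    that point in direction [v], the difference of the two square roots is an
    affine function of the parameter [t].  Put the origin of [t] at the vertex
    of the first radicand, which becomes [a t^2 + h] with [a > 0], hence even.
    Comparing the parameters [t] and [-t] kills the slope; then
    [sqrt (a t^2 + h)] times twice the intercept is a polynomial in [t], which
    forces the intercept to vanish ([sqrt_quadratics_affine]).  So the affine parts
    agree at every point ([affine_part_eq]), the radicands are equal, and
    comparing quadratic polynomials ([quad_part_eq]) gives [M], [M xs] and
    [delta ^ 2].  When [M = 0] the function is affine; by symmetry the other
    matrix vanishes too, and only [c] and [d - delta] can be recovered.

    The ambiguity left for nonzero [M] is a translation of [xs] by the kernel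
    of [M], which is trivial exactly when [M] is positive definite; as [n > 0],
    a matrix with trivial kernel is nonzero.

    Positive semidefiniteness is a condition on eigenvalues, while the argument
    uses [quad M x >= 0].  The bridge is [symmetric_least_eigenvalue]: the
    infimum of the Rayleigh quotient of a symmetric matrix is an eigenvalue.
    It is obtained without compactness: if [a] is this infimum, [M - a] is
    positive semidefinite, and were it invertible it would be bounded below by
    a positive multiple of the identity ([quad_coercive]), so that [a] could be
    increased. *)

(** * Quadratic forms and the least eigenvalue of a symmetric matrix *)

Section QuadraticForms.
Variables (R : realType) (n : nat).
Implicit Types (u v w x y : 'cV[R]_n) (A B M : 'M[R]_n).

Definition dot u v : R := (u^T *m v) 0 0.

Lemma dotE u v : dot u v = \sum_i u i 0 * v i 0.
Proof. by rewrite /dot mxE; apply: eq_bigr => i _; rewrite mxE. Qed.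

Lemma dotC u v : dot u v = dot v u.
Proof. by rewrite !dotE; apply: eq_bigr => i _; rewrite mulrC. Qed.

Lemma dotDr u v w : dot u (v + w) = dot u v + dot u w.
Proof. by rewrite /dot mulmxDr mxE. Qed.

Lemma dotZr a u v : dot u (a *: v) = a * dot u v.
Proof. by rewrite /dot -scalemxAr mxE. Qed.

Lemma dotNr u v : dot u (- v) = - dot u v.
Proof. by rewrite -scaleN1r dotZr mulN1r. Qed.

Lemma dot0r u : dot u 0 = 0.
Proof. by rewrite /dot mulmx0 mxE. Qed.

Lemma dotDl u v w : dot (u + v) w = dot u w + dot v w.
Proof. by rewrite ![dot _ w]dotC dotDr. Qed.

Lemma dotZl a u v : dot (a *: u) v = a * dot u v.
Proof. by rewrite ![dot _ v]dotC dotZr. Qed.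

Lemma dotNl u v : dot (- u) v = - dot u v.
Proof. by rewrite ![dot _ v]dotC dotNr. Qed.

Lemma dot_mulmxl A u v : dot (A *m u) v = dot u (A^T *m v).
Proof. by rewrite /dot trmx_mul mulmxA. Qed.

Lemma dot_ge0 u : 0 <= dot u u.
Proof. by rewrite dotE sumr_ge0 // => i _; rewrite -expr2 sqr_ge0. Qed.

Lemma dot_eq0 u : (dot u u == 0) = (u == 0).
Proof.
apply/eqP/eqP => [|->]; last exact: dot0r.
rewrite dotE => /eqP; rewrite psumr_eq0; last first.
  by move=> i _; rewrite -expr2 sqr_ge0.
move=> /allP u0; apply/colP => i; rewrite mxE; apply/eqP.
by have := u0 i (mem_index_enum _); rewrite /= mulf_eq0 orbb.
Qed.

Lemma dot_gt0 u : (0 < dot u u) = (u != 0).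
Proof. by rewrite lt_neqAle dot_ge0 andbT eq_sym dot_eq0. Qed.

Lemma dot_inj u v : (forall x, dot u x = dot v x) -> u = v.
Proof.
move=> uv; apply/eqP; rewrite -subr_eq0 -dot_eq0 dotDl dotNl uv.
by rewrite subrr.
Qed.

Definition quad A x : R := dot x (A *m x).

Lemma quadD A x y : A^T = A ->
  quad A (x + y) = quad A x + 2 * dot y (A *m x) + quad A y.
Proof.
move=> sA; rewrite /quad mulmxDr !dotDr !dotDl.
rewrite [dot x (A *m y)]dotC dot_mulmxl sA; ring.
Qed.

Lemma quadZ A a x : quad A (a *: x) = a ^+ 2 * quad A x.
Proof. by rewrite /quad -scalemxAr dotZr dotZl mulrA. Qed.

Lemma quadN A x : quad A (- x) = quad A x.
Proof. by rewrite -scaleN1r quadZ sqrrN expr1n mul1r. Qed.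

(** By polarization the bilinear form vanishes, hence so does [A *m y], whose
    square norm is a value of that form. *)
Lemma quad_eq0 A : A^T = A -> (forall x, quad A x = 0) -> A = 0.
Proof.
move=> sA A0.
have Axy x y : dot x (A *m y) = 0.
  by have := quadD y x sA; rewrite !A0; lra.
apply/matrixP => i j; rewrite mxE.
have -> : A i j = (A *m delta_mx j (0 : 'I_1)) i 0 by rewrite -colE mxE.
suff -> : A *m delta_mx j (0 : 'I_1) = 0 by rewrite mxE.
by apply/eqP; rewrite -dot_eq0 Axy.
Qed.

(** Each product of two coordinates of [x] is at most [dot x x] in absolute
    value, so the sum of the absolute values of the entries of [A] would do; the
    extra [1] makes [C] positive even for [A = 0]. *)
Lemma quad_bound A :
  exists2 C, 0 < C & forall x, `|quad A x| <= C * dot x x.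
Proof.
exists (1 + \sum_i \sum_j `|A i j|).
  rewrite ltr_wpDr //; apply: sumr_ge0 => i _; exact: sumr_ge0.
move=> x; have coord i : x i 0 ^+ 2 <= dot x x.
  rewrite dotE (bigD1 i) //= expr2 lerDl sumr_ge0 // => j _.
  by rewrite -expr2 sqr_ge0.
have mixed i j : `|x i 0 * x j 0| <= dot x x.
  have xi := coord i; have xj := coord j.
  have sq1 := sqr_ge0 (x i 0 - x j 0); have sq2 := sqr_ge0 (x i 0 + x j 0).
  by rewrite ler_norml; apply/andP; split; nra.
rewrite mulrDl mul1r ler_wpDl ?dot_ge0 //.
rewrite /quad dotE (le_trans (ler_norm_sum _ _ _)) // mulr_suml.
apply: ler_sum => i _; rewrite mxE mulr_sumr mulr_suml.
apply: (le_trans (ler_norm_sum _ _ _)); apply: ler_sum => j _.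
by rewrite mulrCA normrM ler_wpM2l.
Qed.

(** Invertibility bounds [x] by [y = A x].  In turn [y] is controlled by
    [quad A x]: nonnegativity of the form at [x - y / C] reads
    [2 |y|^2 / C <= quad A x + quad A y / C^2], and the last term is at most
    [|y|^2 / C] when [C] bounds the form. *)
Lemma quad_coercive A : A^T = A -> A \in unitmx ->
  (forall x, 0 <= quad A x) ->
  exists2 e, 0 < e & forall x, e * dot x x <= quad A x.
Proof.
move=> sA uA A0.
have [C C0 hC] := quad_bound A.
have [D D0 hD] := quad_bound ((invmx A)^T *m invmx A).
exists ((C * D)^-1) => [|x]; first by rewrite invr_gt0 mulr_gt0.
set y := A *m x.
have xy : dot x x <= D * dot y y.
  have <- : quad ((invmx A)^T *m invmx A) y = dot x x.
    by rewrite /quad -mulmxA -dot_mulmxl mulKmx.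
  exact: le_trans (ler_norm _) (hD y).
have yAx : dot y y <= C * quad A x.
  have := A0 (x + (- C^-1) *: y).
  rewrite quadD // quadZ dotZl -/y.
  have := le_trans (ler_norm _) (hC y).
  have : C^-1 * C = 1 by rewrite mulVf ?gt_eqF.
  have : 0 < C^-1 by rewrite invr_gt0.
  set c := C^-1 => c0 cC hy h.
  have h1 : c ^+ 2 * quad A y <= c * dot y y.
    rewrite (_ : c * dot y y = c ^+ 2 * (C * dot y y)).
      by rewrite ler_wpM2l ?sqr_ge0.
    by rewrite mulrA expr2 -[c * c * C]mulrA cC mulr1.
  have h2 : c * dot y y <= quad A x by nra.
  have := ler_wpM2l (ltW C0) h2.
  by rewrite mulrA [C * c]mulrC cC mul1r.
rewrite ler_pdivrMl ?mulr_gt0 //; apply: (le_trans xy).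
by rewrite -mulrA mulrCA ler_wpM2l // ltW.
Qed.

(** The infimum of the Rayleigh quotient is the supremum [a] of its lower
    bounds, and is itself a lower bound.  If it were not an eigenvalue,
    [M - a%:M] would be invertible, hence coercive, and [a] would not be the
    greatest lower bound. *)
Lemma symmetric_least_eigenvalue M : (0 < n)%N -> M^T = M ->
  exists2 a, eigenvalue M a & forall x, a * dot x x <= quad M x.
Proof.
move=> n0 sM; have [C C0 hC] := quad_bound M.
pose S : set R := [set s | forall x, s * dot x x <= quad M x]%classic.
have SC : S (- C).
  by move=> x; have := hC x; rewrite ler_norml mulNr => /andP[].
pose e : 'cV[R]_n := delta_mx (Ordinal n0) 0.
have e0 : 0 < dot e e.
  rewrite dot_gt0; apply/eqP => /matrixP /(_ (Ordinal n0) 0).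
  by rewrite !mxE !eqxx => /eqP; rewrite oner_eq0.
have supS : has_sup S.
  split; first by exists (- C).
  exists C => s /(_ e) se; rewrite -(ler_pM2r e0).
  exact: le_trans se (le_trans (ler_norm _) (hC e)).
have aS : S (sup S).
  move=> x; have [->|x0] := eqVneq x 0.
    by rewrite /quad mulmx0 dot0r mulr0.
  have xx : 0 < dot x x by rewrite dot_gt0.
  rewrite -ler_pdivlMr //; apply: ge_sup; first by exists (- C).
  by move=> s /(_ x); rewrite ler_pdivlMr.
exists (sup S) => //; set a := sup S in aS *.
pose A := M - a%:M.
have sA : A^T = A by rewrite /A linearB /= sM tr_scalar_mx.
have quadA x : quad A x = quad M x - a * dot x x.
  by rewrite /quad /A mulmxBl mul_scalar_mx dotDr dotNr dotZr.
have [uA|nuA] := boolP (A \in unitmx).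
  have [|eps eps0 heps] := quad_coercive sA uA.
    by move=> x; rewrite quadA subr_ge0 aS.
  have : S (a + eps).
    by move=> x; have := heps x; rewrite quadA mulrDl; lra.
  move=> /(sup_upper_bound supS); rewrite -/a; lra.
by rewrite /eigenvalue /eigenspace kermx_eq0 row_free_unit.
Qed.

Lemma psdmx_quad_ge0 M : psdmx M -> forall x, 0 <= quad M x.
Proof.
move=> [sM eM] x; have [n0|n0] := posnP n.
  suff -> : x = 0 by rewrite /quad mulmx0 dot0r.
  by apply/colP => i; have := ltn_ord i; rewrite {2}n0.
have [a /eM a0 ha] := symmetric_least_eigenvalue n0 sM.
exact: le_trans (mulr_ge0 a0 (dot_ge0 x)) (ha x).
Qed.

Lemma psdmx_pd M : psdmx M ->
  (pdmx M <-> forall x, M *m x = 0 -> x = 0).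
Proof.
move=> [sM eM]; split => [[_ pM] x Mx|inj].
  apply/eqP/negPn/negP => x0.
  suff /pM : eigenvalue M 0 by rewrite ltxx.
  apply/eigenvalueP; exists x^T; last by rewrite trmx_eq0.
  by rewrite scale0r -[M]trmxK -trmx_mul sM Mx trmx0.
split => // a ea; rewrite lt_neqAle eM // andbT.
apply/eqP => a0; move: ea; rewrite -a0 => /eigenvalueP[v vM /negP[]].
rewrite -trmx_eq0; apply/eqP/inj.
by rewrite -{1}sM -trmx_mul vM scale0r trmx0.
Qed.

End QuadraticForms.

(** * Differences of square roots of quadratic polynomials *)

(** The first radicand is centred at its vertex, which makes its square root an
    even function of [t]; the second one is arbitrary. *)
Lemma sqrt_quadratics_affine (R : realType) (a h a' b' g' al be : R) :
  0 < a -> 0 <= h ->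
  (forall t, 0 <= a' * t ^+ 2 + b' * t + g') ->
  (forall t, Num.sqrt (a * t ^+ 2 + h)
             - Num.sqrt (a' * t ^+ 2 + b' * t + g') = al * t + be) ->
  al = 0 /\ be = 0.
Proof.
move=> a0 h0 p'0 E.
pose r t : R := Num.sqrt (a * t ^+ 2 + h).
have r2 t : r t ^+ 2 = a * t ^+ 2 + h.
  rewrite /r sqr_sqrtr // addr_ge0 // mulr_ge0 ?sqr_ge0 //; exact: ltW.
have rN t : r (- t) = r t by rewrite /r sqrrN.
have E2 t : (r t - (al * t + be)) ^+ 2 = a' * t ^+ 2 + b' * t + g'.
  rewrite -[RHS]sqr_sqrtr // /r -E; congr (_ ^+ 2); ring.
(* The odd part in [t] of [E2], divided by [t]. *)
have odd t : t != 0 -> - 2 * al * (r t - be) = b'.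
  move=> t0; apply: (mulfI t0); have := E2 t; have := E2 (- t); rewrite rN.
  nra.
have n10 : (1 : R) != 0 by rewrite oner_eq0.
have n20 : (2 : R) != 0 by rewrite pnatr_eq0.
(* [r] takes different values at 1 and 2, so its coefficient in [odd] is 0. *)
have al0 : al = 0.
  have d12 : al * (r 2 - r 1) = 0 by have := odd _ n10; have := odd _ n20; lra.
  move/eqP: d12; rewrite mulf_eq0 => /orP[/eqP //|/eqP r12].
  by have := r2 1; have := r2 2; rewrite (_ : r 2 = r 1); [nra|lra].
split=> //; move: E2; rewrite al0 => E2.
have b'0 : b' = 0 by rewrite -(odd _ n10) al0; ring.
apply/eqP/negPn/negP => be0.
(* What remains of [E2] says that [2 * be * r t] is the polynomial
   [A * t ^+ 2 + B]; its square has no term of degree 4, so [A = 0] and [r]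
   would be constant. *)
pose A := a - a'; pose B := h + be ^+ 2 - g'.
have sq t : 4 * be ^+ 2 * (a * t ^+ 2 + h) = (A * t ^+ 2 + B) ^+ 2.
  have -> : A * t ^+ 2 + B = 2 * be * r t.
    by have := E2 t; have := r2 t; rewrite b'0 /A /B; lra.
  by rewrite -r2; ring.
have sq0 := sq 0; have sq1 := sq 1; have sq2 := sq 2.
have A0 : A = 0 by apply/eqP; rewrite -sqrf_eq0; apply/eqP; lra.
have : 4 * be ^+ 2 * a = 0 by rewrite A0 in sq0 sq1; lra.
by move/eqP; rewrite !mulf_eq0 (gt_eqF a0) (negPf be0) pnatr_eq0.
Qed.

(** * Comparison of two parameterizations *)

Section SquareRootForms.
Variables (R : realType) (n : nat).
Implicit Types (c x v : 'cV[R]_n) (M : 'M[R]_n).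

Lemma sqrt_formE c d delta M xs x :
  sqrt_form c d delta M xs x
  = dot c x + d - Num.sqrt (delta ^+ 2 + quad M (x - xs)).
Proof. by rewrite /sqrt_form /quad /dot mulmxA. Qed.

(** The lines used are directed by a fixed [v] with [quad M v > 0], which exists
    because a nonzero symmetric matrix has a nonzero quadratic form. *)
Lemma affine_part_eq c d delta M xs c' d' delta' M' xs' :
  psdmx M -> psdmx M' -> M <> 0 ->
  (forall x, sqrt_form c d delta M xs x = sqrt_form c' d' delta' M' xs' x) ->
  c' = c /\ d' = d.
Proof.
move=> pM pM' M0 E.
have [sM _] := pM; have [sM' _] := pM'.
have qM := psdmx_quad_ge0 pM; have qM' := psdmx_quad_ge0 pM'.
have [v v0] : exists v, quad M v != 0.
  apply: contrapT => noV; apply/M0/quad_eq0 => // x.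
  by apply/eqP/negPn/negP => x0; apply: noV; exists x.
have {v0} : 0 < quad M v by rewrite lt_neqAle eq_sym v0 qM.
set a := quad M v => a0.
have eq_aff x : dot c x + d = dot c' x + d'.
  (* [x0] minimizes the first radicand on the line through [x] directed by [v];
     [x] itself is at parameter [- t0] from it. *)
  pose t0 := - (dot v (M *m (x - xs)) / a).
  pose x0 := x + t0 *: v.
  have center : dot v (M *m (x0 - xs)) = 0.
    rewrite /x0 addrAC mulmxDr dotDr -scalemxAr dotZr -/(quad M v) -/a /t0.
    by field; rewrite gt_eqF.
  have p t : delta ^+ 2 + quad M (x0 + t *: v - xs)
      = a * t ^+ 2 + (delta ^+ 2 + quad M (x0 - xs)).
    by rewrite (addrAC x0) (quadD (x0 - _)) // quadZ dotZl center -/a; ring.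
  have p' t : delta' ^+ 2 + quad M' (x0 + t *: v - xs')
      = quad M' v * t ^+ 2 + 2 * dot v (M' *m (x0 - xs')) * t
        + (delta' ^+ 2 + quad M' (x0 - xs')).
    by rewrite (addrAC x0) (quadD (x0 - _)) // quadZ dotZl; ring.
  have [|t||al0 be0] := @sqrt_quadratics_affine R a
      (delta ^+ 2 + quad M (x0 - xs)) (quad M' v)
      (2 * dot v (M' *m (x0 - xs'))) (delta' ^+ 2 + quad M' (x0 - xs'))
      (dot c v - dot c' v) (dot c x0 + d - (dot c' x0 + d')) a0.
  - by rewrite addr_ge0 ?sqr_ge0.
  - by rewrite -p' addr_ge0 ?sqr_ge0.
  - move=> t; rewrite -p -p'; have := E (x0 + t *: v); rewrite !sqrt_formE.
    by rewrite !dotDr !dotZr; lra.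
  rewrite /x0 !dotDr !dotZr in be0.
  have -> : dot c x + d = dot c' x + d' - t0 * (dot c v - dot c' v) by lra.
  by rewrite al0 mulr0 subr0.
have dd : d' = d by have := eq_aff 0; rewrite !dot0r; lra.
split=> //; apply: dot_inj => x; have := eq_aff x; rewrite dd; lra.
Qed.

(** The even and odd parts in [x] separate the quadratic terms from the linear
    ones.  The value at [0] then gives the constants, since
    [quad M xs] depends on [xs] only through [M *m xs]. *)
Lemma quad_part_eq e M xs e' M' xs' :
  M^T = M -> M'^T = M' ->
  (forall x, e + quad M (x - xs) = e' + quad M' (x - xs')) ->
  [/\ M' = M, M *m xs' = M *m xs & e' = e].
Proof.
move=> sM sM' E.
pose L x := dot x (M *m xs); pose L' x := dot x (M' *m xs').
have {}E x : e + (quad M x - 2 * L x + quad M xs)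
    = e' + (quad M' x - 2 * L' x + quad M' xs').
  have := E x; rewrite !quadD // !quadN /L /L' !dotNl.
  have sw A z : A^T = A -> dot z (A *m x) = dot x (A *m z).
    by move=> sA; rewrite dotC dot_mulmxl sA.
  by rewrite !sw //; lra.
have LN x : L (- x) = - L x by rewrite /L dotNl.
have LN' x : L' (- x) = - L' x by rewrite /L' dotNl.
have EN x := E (- x).
have E0 : e + quad M xs = e' + quad M' xs'.
  have := E 0; rewrite /L /L' /quad !mulmx0 dotC !dot0r.
  by rewrite ![dot 0 _]dotC !dot0r; lra.
have MM' : M' = M.
  apply/eqP; rewrite -subr_eq0; apply/eqP/quad_eq0.
    by rewrite linearB /= sM sM'.
  move=> x; rewrite /quad mulmxBl dotDr dotNr -!/(quad _ _).
  by have := E x; have := EN x; rewrite !quadN LN LN'; lra.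
have Lxs : M *m xs' = M *m xs.
  rewrite -{1}MM'; apply: dot_inj => x; rewrite ![dot _ x]dotC.
  rewrite -/(L x) -/(L' x).
  by have := E x; have := EN x; rewrite !quadN LN LN'; lra.
split=> //; move: E0; rewrite MM' /quad Lxs.
by rewrite [dot xs' _]dotC dot_mulmxl sM Lxs; lra.
Qed.

Lemma sqrt_form_inj c d delta M xs c' d' delta' M' xs' :
  0 <= delta -> 0 <= delta' -> psdmx M -> psdmx M' -> M <> 0 ->
  (forall x, sqrt_form c d delta M xs x = sqrt_form c' d' delta' M' xs' x) ->
  [/\ c' = c, d' = d, delta' = delta, M' = M & M *m xs' = M *m xs].
Proof.
move=> de0 de0' pM pM' M0 E; have [cc dd] := affine_part_eq pM pM' M0 E.
have [|||MM' Mxs dede] :=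
  @quad_part_eq (delta ^+ 2) M xs (delta' ^+ 2) M' xs'.
- by case: pM.
- by case: pM'.
- move=> x; have := E x; rewrite !sqrt_formE cc dd => /addrI/oppr_inj/eqP.
  by rewrite eqr_sqrt ?addr_ge0 ?sqr_ge0 ?psdmx_quad_ge0 // => /eqP.
split=> //; apply/eqP; rewrite -(eqrXn2 (n := 2)) //; exact/eqP.
Qed.

Lemma sqrt_form_M0 c d delta xs x : 0 <= delta ->
  sqrt_form c d delta 0 xs x = dot c x + (d - delta).
Proof.
move=> de0; rewrite sqrt_formE /quad mul0mx dot0r addr0.
by rewrite sqrtr_sqr ger0_norm // addrA.
Qed.

Lemma sqrt_form_shift c d delta M xs z x : M^T = M -> M *m z = 0 ->
  sqrt_form c d delta M (xs + z) x = sqrt_form c d delta M xs x.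
Proof.
move=> sM Mz; rewrite !sqrt_formE opprD addrA (quadD (x - xs)) // quadN.
have -> : quad M z = 0 by rewrite /quad Mz dot0r.
have -> : dot (- z) (M *m (x - xs)) = 0.
  by rewrite dotNl dotC dot_mulmxl sM Mz dot0r oppr0.
by rewrite mulr0 !addr0.
Qed.

End SquareRootForms.

Theorem theorem10 (R : realType) (n : nat) (hn : (0 < n)%N)
    (f : 'cV[R]_n -> R)
    (c : 'cV[R]_n) (d delta : R) (M : 'M[R]_n) (xs : 'cV[R]_n)
    (hf : parameterizes f c d delta M xs) :
  (forall (c' : 'cV[R]_n) (d' delta' : R) (M' : 'M[R]_n) (xs' : 'cV[R]_n),
     parameterizes f c' d' delta' M' xs' ->
     (M = 0 ->
        [/\ c' = c, M' = 0, d' - delta' = d - delta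
          & forall y : 'cV[R]_n, parameterizes f c' d' delta' M' y])
     /\
     (M <> 0 ->
        [/\ c' = c, d' = d, delta' = delta, M' = M & M *m xs' = M *m xs]))
  /\
  (unique_parameterization f c d delta M xs <-> pdmx M).
Proof.
have [de0 pM fE] := hf.
split; first move=> c' d' delta' M' xs' [de0' pM' fE'].
  have E x : sqrt_form c d delta M xs x = sqrt_form c' d' delta' M' xs' x.
    by rewrite -fE.
  split=> [M0|M0]; last exact: sqrt_form_inj.
  (* Otherwise the rigidity of forms with nonzero matrix would give [M = M']. *)
  have M'0 : M' = 0.
    apply: contrapT => M'0.
    have [_ _ _ MM' _] :=
      sqrt_form_inj de0' de0 pM' pM M'0 (fun x => esym (E x)).
    by apply: M'0; rewrite -MM'.
  have {}E x : dot c x + (d - delta) = dot c' x + (d' - delta').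
    by have := E x; rewrite M0 M'0 !sqrt_form_M0.
  have dd : d' - delta' = d - delta by have := E 0; rewrite !dot0r; lra.
  split=> //; first by apply: dot_inj => x; have := E x; rewrite dd; lra.
  move=> y; split=> // x.
  by rewrite fE' M'0 !sqrt_form_M0.
have [sM _] := pM; rewrite psdmx_pd //; split=> [uniqf z Mz|inj].
  have par : parameterizes f c d delta M (xs + z).
    by split=> // x; rewrite fE sqrt_form_shift.
  have [xsz] := uniqf _ _ _ _ _ par.
  by apply: (addrI xs); rewrite xsz addr0.
move=> c' d' delta' M' xs' [de0' pM' fE'].
have M0 : M <> 0.
  move=> M0; have /matrixP/(_ (Ordinal hn) 0) :
      (const_mx 1 : 'cV[R]_n) = 0 by apply: inj; rewrite M0 mul0mx.
  by rewrite !mxE => /eqP; rewrite oner_eq0.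
have [|-> -> -> -> Mxs] :=
    @sqrt_form_inj R n c d delta M xs c' d' delta' M' xs' de0 de0' pM pM' M0.
  by move=> x; rewrite -fE.
congr (_, _); apply/eqP; rewrite -subr_eq0; apply/eqP/inj.
by rewrite mulmxBr Mxs subrr.
Qed.
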